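(* Let $\mathcal{P}^i(x^i),\mathcal{P}^j(x^j)\subset\mathbb{R}^2$ be state-dependent polygons satisfying the standing assumptions listed in the context, and let $h_s,h_a:\mathbb{R}^{2n}\to\mathbb{R}$ and $\mathcal{S}=\{x: h_s(x)\ge 0\}$ be as defined there. Then: 1) $h_s(x)\ge h_a(x)$ if $x\in\mathcal{S}$, and $h_s(x)=h_a(x)$ if $x\in\overline{\mathcal{S}^c}=\partial\mathcal{S}\cup\mathcal{S}^c$. 2) As a consequence, for all $x\in\mathbb{R}^{2n}$: $$h_a(x)=0\iff x\in\partial\mathcal{S},\qquad h_a(x)>0\iff x\in\operatorname{Int}(\mathcal{S}),\qquad h_a(x)<0\iff x\in\mathcal{S}^c .$$
   Context: Notation: $[r]=\{1,\dots,r\}$; $\|\cdot\|$ is the Euclidean norm; $\mathcal{S}^c$ is the complement of $\mathcal{S}$ in $\mathbb{R}^{2n}$. Polygons. Let $n\ge 2$. For $\mathfrak{i}\in\{i,j\}$ and $x^{\mathfrak i}\in\mathbb{R}^n$, let $\mathcal{P}^{\mathfrak i}(x^{\mathfrak i})\subset\mathbb{R}^2$ be a polygon with $r^{\mathfrak i}$ edges and $r^{\mathfrak i}$ vertices, given both as $\mathcal{P}^{\mathfrak i}(x^{\mathfrak i})=\bigcap_{k\in[r^{\mathfrak i}]}\mathcal{P}^{\mathfrak i}_{k}(x^{\mathfrak i})$, with half-planes $\mathcal{P}^{\mathfrak i}_{k}(x^{\mathfrak i})=\{z\in\mathbb{R}^2:(A^{\mathfrak i}_k(x^{\mathfrak i}))^\top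 z\le b^{\mathfrak i}_k(x^{\mathfrak i})\}$, and as $\mathcal{P}^{\mathfrak i}(x^{\mathfrak i})=\operatorname{co}\{v^{\mathfrak i}_k(x^{\mathfrak i}):k\in[r^{\mathfrak i}]\}$ (convex hull), the $v^{\mathfrak i}_k(x^{\mathfrak i})\in\mathbb{R}^2$ being its vertices. Standing assumptions, for $\mathfrak{i}\in\{i,j\}$ and all $x^{\mathfrak i}\in\mathbb{R}^n$: $\mathcal{P}^{\mathfrak i}(x^{\mathfrak i})$ is convex, bounded, with non-empty interior; the maps $A^{\mathfrak i}_k:\mathbb{R}^n\to\mathbb{R}^2$ and $b^{\mathfrak i}_k:\mathbb{R}^n\to\mathbb{R}$ are continuously differentiable, and none of the $r^{\mathfrak i}$ inequalities is redundant; $\|A^{\mathfrak i}_k(x^{\mathfrak i})\|=1$ for every $k$; the maps $v^{\mathfrak i}_k:\mathbb{R}^n\to\mathbb{R}^2$ are continuously differentiable with Jacobian $\partial v^{\mathfrak i}_k/\partial x^{\mathfrak i}$ (a $2\times n$ matrix) always of full row rank. Write $x=[(x^i)^\top,(x^j)^\top]^\top\in\mathbb{R}^{2n}$. Signed distance. For convex sets $\mathcal{A},\mathcal{B}\subset\mathbb{R}^2$, $\operatorname{sd}(\mathcal{A},\mathcal{B})=\operatorname{dist}(\mathcal{A},\mathcal{B})-\operatorname{pen}(\mathcal{A},\mathcal{B})$, where $\operatorname{dist}(\mathcal{A},\mathcal{B})=\inf_t\{\|t\|:(\mathcal{A}+t)\cap\mathcal{B}\ne\emptyset\}$ and $\operatorname{pen}(\mathcal{A},\mathcal{B})=\inf_t\{\|t\|:(\mathcal{A}+t)\cap\mathcal{B}=\emptyset\}$.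 For a closed convex set $\mathcal{Q}$, $\emptyset\neq\mathcal{Q}\subsetneq\mathbb{R}^2$, this gives $\operatorname{sd}(0,\mathcal{Q})=d(0,\partial\mathcal{Q})$ if $0\notin\mathcal{Q}$ and $\operatorname{sd}(0,\mathcal{Q})=-d(0,\partial\mathcal{Q})$ if $0\in\mathcal{Q}$, where $d(0,\mathcal{Q}')=\inf_{q\in\mathcal{Q}'}\|q\|$. Set $h_s(x)=\operatorname{sd}(\mathcal{P}^i(x^i),\mathcal{P}^j(x^j))$. Lower bound. For sets, $\mathcal{A}-\mathcal{B}=\{a-b:a\in\mathcal{A},b\in\mathcal{B}\}$. Define $\mathcal{Q}_k(x)=\mathcal{P}^j(x^j)-\mathcal{P}^i_{k}(x^i)$ for $k\in[r^i]$, and $\mathcal{Q}_{r^i+k^j}(x)=\mathcal{P}^j_{k^j}(x^j)-\mathcal{P}^i(x^i)$ for $k^j\in[r^j]$; each is a closed half-plane. Set $h_a(x)=\max_{k\in[r^i+r^j]}\operatorname{sd}(0,\mathcal{Q}_k(x))$. *)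

(* Defs.v *)
From HB Require Import structures.
From mathcomp Require Import all_boot all_order all_algebra.
From mathcomp Require Import all_classical all_reals all_analysis.

Set Implicit Arguments.
Unset Strict Implicit.
Unset Printing Implicit Defensive.

Import Order.TTheory GRing.Theory Num.Theory.
Import numFieldNormedType.Exports.

Local Open Scope classical_set_scope.
Local Open Scope ring_scope.

Section euclidean.
Context {R : realType}.

Definition dot n (u v : 'rV[R]_n) : R := \sum_(i < n) u ord0 i * v ord0 i.

(* The library norm `|u| on 'rV[R]_n is the sup norm. Both norms induce the
   same topology and the same bounded sets, so only metric quantities need
   [enorm]. *)
Definition enorm n (u : 'rV[R]_n) : R := Num.sqrt (dot u u).

Definition frontier (T : topologicalType) (A : set T) : set T :=
  closure A `\` A°.

(* On the finite-dimensional domain 'rV[R]_n, continuity of x |-> 'd f x u for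
   every direction u is the same as continuity of the derivative x |-> 'd f x
   for the operator norm, i.e. of all the entries of the Jacobian matrix. *)
Definition C1 n (W : normedModType R) (f : 'rV[R]_n -> W) : Prop :=
  (forall x, differentiable f x) /\
  (forall u : 'rV[R]_n, continuous (fun x => 'd f x u)).

Definition convex_hull n r (p : 'I_r -> 'rV[R]_n) : set 'rV[R]_n :=
  [set z | exists w : 'I_r -> R,
     [/\ forall k, 0 <= w k, \sum_k w k = 1 & z = \sum_k w k *: p k]].

Definition extreme_point n (A : set 'rV[R]_n) (p : 'rV[R]_n) : Prop :=
  A p /\ forall (a b : 'rV[R]_n) (t : R), A a -> A b -> 0 < t < 1 ->
    p = t *: a + (1 - t) *: b -> a = p /\ b = p.

Definition translate n (A : set 'rV[R]_n) (t : 'rV[R]_n) : set 'rV[R]_n :=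
  [set a + t | a in A].

Definition minkowski_sub n (A B : set 'rV[R]_n) : set 'rV[R]_n :=
  [set a - b | a in A & b in B].

(* [inf] is the real infimum, which is 0 on the empty set. For the sets to
   which [sd] is applied below (nonempty, with a difference that is not the
   whole plane) the two sets of norms are nonempty. *)
Definition dist n (A B : set 'rV[R]_n) : R :=
  inf [set enorm t | t in [set t | translate A t `&` B !=set0]].

Definition pen n (A B : set 'rV[R]_n) : R :=
  inf [set enorm t | t in [set t | translate A t `&` B = set0]].

Definition sd n (A B : set 'rV[R]_n) : R := dist A B - pen A B.

End euclidean.

Record state_polygon (R : realType) (n r : nat) := StatePolygon {
  normal : 'I_r -> 'rV[R]_n -> 'rV[R]_2;
  offset : 'I_r -> 'rV[R]_n -> R;
  vertex : 'I_r -> 'rV[R]_n -> 'rV[R]_2 }.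

Section polygons.
Context {R : realType} {n : nat}.

Definition halfplane r (P : state_polygon R n r) (k : 'I_r) (x : 'rV[R]_n) :
    set 'rV[R]_2 :=
  [set z | dot (normal P k x) z <= offset P k x].

Definition region r (P : state_polygon R n r) (x : 'rV[R]_n) : set 'rV[R]_2 :=
  \bigcap_(k in [set: 'I_r]) halfplane P k x.

(* [jacobian f x] acts on row vectors on the right, so it is the transpose of
   the usual 2 x n Jacobian matrix. *)
Record standing_assumptions r (P : state_polygon R n r) : Prop :=
  StandingAssumptions {
    region_hull : forall x, region P x = convex_hull (fun k => vertex P k x);
    vertex_inj : forall x, injective (fun k => vertex P k x);
    vertex_extreme : forall x k, extreme_point (region P x) (vertex P k x);
    region_convex :
      forall x, convex_set (region P x : set (convex_lmodType 'rV[R]_2));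
    region_bounded : forall x, bounded_set (region P x);
    region_interior : forall x, (region P x)° !=set0;
    normal_C1 : forall k, C1 (normal P k);
    offset_C1 : forall k, C1 (offset P k : 'rV[R]_n -> R^o);
    irredundant : forall x k,
      \bigcap_(l in [set l : 'I_r | l != k]) halfplane P l x <> region P x;
    normal_unit : forall x k, enorm (normal P k x) = 1;
    vertex_C1 : forall k, C1 (vertex P k);
    vertex_rank : forall x k, row_free (jacobian (vertex P k) x)^T }.

Section pair.
Context {ri rj : nat} (Pi : state_polygon R n ri) (Pj : state_polygon R n rj).
Implicit Type x : 'rV[R]_(n + n).

Definition h_s x : R := sd (region Pi (lsubmx x)) (region Pj (rsubmx x)).

Definition safe_set : set 'rV[R]_(n + n) := [set x | 0 <= h_s x].

Definition Q (k : 'I_(ri + rj)) x : set 'rV[R]_2 :=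
  match fintype.split k with
  | inl ki => minkowski_sub (region Pj (rsubmx x)) (halfplane Pi ki (lsubmx x))
  | inr kj => minkowski_sub (halfplane Pj kj (rsubmx x)) (region Pi (lsubmx x))
  end.

(* The maximum is computed in \bar R only to have the neutral element -oo; it
   is finite as soon as 0 < ri + rj, which [standing_assumptions] forces. *)
Definition h_a x : R :=
  fine (\big[maxe/-oo%E]_(k < ri + rj) (sd [set 0] (Q k x))%:E).

End pair.
End polygons.

(* Main.v *)
(** Let C = P^j - P^i. Then h_s compares the distances from 0 to C and to the
    complement of C, while sd(0, Q_k) = - c_k when Q_k = {t : a_k . t <= c_k}
    with a_k a unit vector. The separating axis theorem C = \bigcap_k Q_k is
    Helly's theorem in the plane: if P^i + t and P^j are disjoint, then some
    three of the half-planes that define them have empty intersection, one of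
    the polygons contributes at most one of these, and that half-plane misses
    the other polygon. Hence h_a <= h_s when h_a > 0 and h_a = h_s when
    h_a <= 0. It remains to perturb x when h_a(x) = 0: a point of largest norm
    in P^i `&` P^j is a vertex of one of the polygons, since otherwise segments
    of both would cross there and 0 would be interior to C; by the rank
    condition this vertex can be pushed into the interior of the other
    polygon, which makes h_s negative. *)
Require Import Defs.
From mathcomp Require Import all_boot all_order all_algebra.
From mathcomp Require Import ring lra.
From mathcomp Require Import all_classical all_reals all_analysis.
Import Order.TTheory GRing.Theory Num.Theory.
Import numFieldNormedType.Exports.
Local Open Scope classical_set_scope.
Local Open Scope ring_scope.

(** * Inner product, distance to the origin and signed distance to half-spaces *)

Section euclidean_geometry.
Context {R : realType} {n : nat}.
Implicit Types (a t u v : 'rV[R]_n) (A B X : set 'rV[R]_n).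

Lemma dotC u v : dot u v = dot v u.
Proof. by apply: eq_bigr => i _; rewrite mulrC. Qed.

Lemma dotDr u v w : dot u (v + w) = dot u v + dot u w.
Proof.
by rewrite /dot -big_split; apply: eq_bigr => i _; rewrite mxE mulrDr.
Qed.

Lemma dotZr u v c : dot u (c *: v) = c * dot u v.
Proof.
by rewrite /dot big_distrr; apply: eq_bigr => i _; rewrite mxE /= mulrCA.
Qed.

Lemma dotNr u v : dot u (- v) = - dot u v.
Proof. by rewrite -scaleN1r dotZr mulN1r. Qed.

Lemma dotBr u v w : dot u (v - w) = dot u v - dot u w.
Proof. by rewrite dotDr dotNr. Qed.

Lemma dotDl u v w : dot (u + v) w = dot u w + dot v w.
Proof. by rewrite dotC dotDr !(dotC w). Qed.

Lemma dotZl u v c : dot (c *: u) v = c * dot u v.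
Proof. by rewrite dotC dotZr dotC. Qed.

Lemma dotNl u v : dot (- u) v = - dot u v.
Proof. by rewrite dotC dotNr dotC. Qed.

Lemma dotBl u v w : dot (u - v) w = dot u w - dot v w.
Proof. by rewrite dotDl dotNl. Qed.

Lemma dot0r u : dot u 0 = 0.
Proof. by rewrite -(scale0r 0) dotZr mul0r. Qed.

Lemma dot_sumr I (r : seq I) (P : pred I) u (F : I -> 'rV[R]_n) :
  dot u (\sum_(i <- r | P i) F i) = \sum_(i <- r | P i) dot u (F i).
Proof.
by elim/big_rec2: _ => [|i y x _ <-]; rewrite ?dot0r ?dotDr.
Qed.

Lemma dot_ge0 u : 0 <= dot u u.
Proof. by apply: sumr_ge0 => i _; rewrite -expr2 sqr_ge0. Qed.

Lemma dot_eq0 u : dot u u = 0 -> u = 0.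
Proof.
move=> /eqP; rewrite psumr_eq0 => [/allP u0|i _]; last first.
  by rewrite -expr2 sqr_ge0.
apply/rowP => i; rewrite mxE.
by have := u0 i (mem_index_enum _); rewrite mulf_eq0 orbb => /eqP.
Qed.

Lemma enorm_ge0 u : 0 <= enorm u.
Proof. exact: sqrtr_ge0. Qed.

Lemma enorm0 : enorm (0 : 'rV[R]_n) = 0.
Proof. by rewrite /enorm dot0r sqrtr0. Qed.

Lemma enormZ c u : enorm (c *: u) = `|c| * enorm u.
Proof.
by rewrite /enorm dotZl dotZr mulrA -expr2 sqrtrM ?sqr_ge0// sqrtr_sqr.
Qed.

Lemma enormN u : enorm (- u) = enorm u.
Proof. by rewrite -scaleN1r enormZ normrN1 mul1r. Qed.

Lemma dot_unit a : enorm a = 1 -> dot a a = 1.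
Proof.
by move=> a1; rewrite -[LHS]sqr_sqrtr ?dot_ge0// -/(enorm a) a1 expr1n.
Qed.

(** Cauchy-Schwarz for a unit vector: the component of [t] orthogonal to [a] has nonnegative squared
    norm. *)
Lemma dot_le_enorm a t : enorm a = 1 -> `|dot a t| <= enorm t.
Proof.
move=> /dot_unit aa; rewrite -sqrtr_sqr ler_wsqrtr//.
have := dot_ge0 (t - dot a t *: a).
rewrite dotBl !dotBr !dotZl !dotZr aa (dotC t a); lra.
Qed.

Lemma coord_le_enorm u i : `|u ord0 i| <= enorm u.
Proof.
rewrite -sqrtr_sqr ler_wsqrtr// expr2 /dot (bigD1 i)//= lerDl sumr_ge0// => j _.
by rewrite -expr2 sqr_ge0.
Qed.

(** Neighbourhoods come from the sup norm, which the Euclidean norm dominates, so the Euclidean ball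
    of the same radius fits inside. *)
Lemma nbhs_enorm_ball A (c : 'rV[R]_n) :
  nbhs c A -> exists2 e, 0 < e & forall t, enorm t < e -> A (c + t).
Proof.
case/nbhs_ballP => e /= e0 cA; exists e => // t te; apply: cA; split => // i j.
rewrite /ball /= mxE opprD addrA subrr sub0r normrN ord1.
exact: le_lt_trans (coord_le_enorm t j) te.
Qed.

Lemma cvg_dot (T : Type) (F : set_system T) (f g : T -> 'rV[R]_n) u v :
    Filter F -> f @ F --> u -> g @ F --> v ->
  dot (f x) (g x) @[x --> F] --> dot u v.
Proof.
move=> FF fu gv; have addc := @add_continuous R.
have fgi (i : 'I_n) : xpredT i ->
    f x ord0 i * g x ord0 i @[x --> F] --> u ord0 i * v ord0 i.
  move=> _; apply: cvgM.
    exact: cvg_comp fu (@coord_continuous _ _ _ _ _ _).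
  exact: cvg_comp gv (@coord_continuous _ _ _ _ _ _).
exact: (@cvg_big R _ +%R 0 xpredT addc T F (index_enum 'I_n) _ _ FF fgi).
Qed.

Lemma dot_continuous : continuous (fun u => dot u u).
Proof. by move=> u; exact: (cvg_dot _ (nbhs u) id id u u _ cvg_id cvg_id). Qed.

(** The distance from the origin to [X], with value 0 when [X] is empty. *)
Definition inf_enorm X : R := inf [set enorm t | t in X].

Lemma inf_enorm_ge0 X : 0 <= inf_enorm X.
Proof.
have [->|/set0P X0] := eqVneq X set0.
  by rewrite /inf_enorm image_set0 inf0.
apply: lb_le_inf; first by case: X0 => t Xt; exists (enorm t), t.
by move=> _ [t _ <-]; exact: enorm_ge0.
Qed.

Lemma inf_enorm_le X t : X t -> inf_enorm X <= enorm t.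
Proof.
move=> Xt; apply: ge_inf; last by exists t.
by exists 0 => _ [u _ <-]; exact: enorm_ge0.
Qed.

Lemma le_inf_enorm X c :
  X !=set0 -> (forall t, X t -> c <= enorm t) -> c <= inf_enorm X.
Proof.
case=> t Xt cX; apply: lb_le_inf; first by exists (enorm t), t.
by move=> _ [u Xu <-]; exact: cX.
Qed.

Lemma inf_enorm_eq0 X : X 0 -> inf_enorm X = 0.
Proof.
move=> X0; apply/eqP.
by rewrite eq_le inf_enorm_ge0 andbT -[leRHS]enorm0 inf_enorm_le.
Qed.

(** The translate of [A] by [t] meets [B] exactly when [t] is a difference [b - a], so both infima
    range over [B - A] or its complement. *)
Lemma sd_minkowski A B :
  sd A B = inf_enorm (minkowski_sub B A) - inf_enorm (~` minkowski_sub B A).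
Proof.
have sub t : (translate A t `&` B) !=set0 <-> minkowski_sub B A t.
  split=> [[_ [[a Aa <-] Bat]]|[b Bb [a Aa <-]]].
    by exists (a + t) => //; exists a => //; rewrite addrC addKr.
  by exists b; split => //; exists a => //; rewrite subrKC.
congr (inf _ - inf _); congr (_ @` _); apply/seteqP; split => t /=.
- by move/sub.
- by move/sub.
- by move=> AB0 /sub; rewrite AB0 => -[].
- by move=> nC; apply/eqP; apply/negPn/negP => /set0P /sub.
Qed.

Definition half a (c : R) : set 'rV[R]_n := [set t | dot a t <= c].

Lemma half0 a c : half a c 0 = (0 <= c).
Proof. by rewrite /half /= dot0r. Qed.

Lemma inf_enorm_sub_half X a c : enorm a = 1 ->
  X !=set0 -> X `<=` half a c -> - c <= inf_enorm X.
Proof.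
move=> a1 X0 Xac; apply: le_inf_enorm => // t /Xac; rewrite /half /= => atc.
apply: le_trans (dot_le_enorm _ t a1).
by rewrite -normrN; apply: le_trans (ler_norm _); rewrite lerN2.
Qed.

Lemma not_half_scale a c d : enorm a = 1 -> c < d -> ~ half a c (d *: a).
Proof.
by move=> a1 cd; rewrite /half /= dotZr dot_unit// mulr1 leNgt cd.
Qed.

Lemma inf_enormC_sub_half X a c : enorm a = 1 -> 0 <= c ->
  X `<=` half a c -> inf_enorm (~` X) <= c.
Proof.
(* The points [(c + e) *: a] lie just beyond the bounding hyperplane, hence outside [X]. *)
move=> a1 c0 Xac; apply/ler_addgt0Pr => e e0.
have ce : c < c + e by rewrite ltrDl.
have <- : enorm ((c + e) *: a) = c + e.
  by rewrite enormZ a1 mulr1 gtr0_norm// (le_lt_trans c0).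
by apply: inf_enorm_le => /Xac; exact: not_half_scale.
Qed.

Lemma sd_half a c : enorm a = 1 -> sd [set 0] (half a c) = - c.
Proof.
move=> a1; rewrite sd_minkowski.
have -> : minkowski_sub (half a c) [set 0] = half a c.
  apply/seteqP; split => [_ [t at_ [_ -> <-]]|t at_]; first by rewrite subr0.
  by exists t => //; exists 0 => //; rewrite subr0.
have [c0|c0] := leP 0 c.
  rewrite inf_enorm_eq0 ?half0// sub0r; congr -%R.
  apply/eqP; rewrite eq_le (inf_enormC_sub_half _ a)//=.
  apply: le_inf_enorm => [|t /= /negP].
    by exists ((c + 1) *: a); apply: not_half_scale => //; rewrite ltrDl.
  rewrite -ltNge => /ltW /le_trans; apply.
  exact: le_trans (ler_norm _) (dot_le_enorm _ t a1).
rewrite [X in _ - X]inf_enorm_eq0 /= ?half0; last by apply/negP; rewrite -ltNge.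
have ca : half a c (c *: a) by rewrite /half /= dotZr dot_unit// mulr1.
rewrite subr0; apply/eqP; rewrite eq_le (inf_enorm_sub_half _ a)//; last first.
  by exists (c *: a).
have <- : enorm (c *: a) = - c by rewrite enormZ a1 mulr1 ltr0_norm.
by rewrite inf_enorm_le.
Qed.

(** [H] is the largest of the numbers [- c k]. If it is positive, the origin lies outside [X] and a
    single half-space bounds the distance from below; the nearest point of [X] may be a corner,
    whence only an inequality. Otherwise the origin lies in [X], and a point outside [X] violates
    some constraint [k], so its norm is at least [c k]. *)
Lemma sd_polyhedron (T : finType) (a : T -> 'rV[R]_n) (c : T -> R) X H :
    (forall k, enorm (a k) = 1) -> X !=set0 ->
    (forall t, X t <-> forall k, half (a k) (c k) t) ->
    (forall k, - c k <= H) -> (exists k, H = - c k) ->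
  (0 < H -> H <= inf_enorm X - inf_enorm (~` X)) /\
  (H <= 0 -> inf_enorm X - inf_enorm (~` X) = H).
Proof.
move=> a1 X0 XE Hc [k0 Hk0]; have Xk k : X `<=` half (a k) (c k).
  by move=> t /XE.
split=> [H0|H0].
  rewrite [X in _ - X]inf_enorm_eq0; last first.
    by move=> /XE /(_ k0); rewrite half0; apply/negP; lra.
  by rewrite subr0 Hk0; exact: inf_enorm_sub_half.
have c0 k : 0 <= c k by have := Hc k; lra.
rewrite inf_enorm_eq0; last by apply/XE => k; rewrite half0.
rewrite sub0r; apply/eqP; rewrite eqr_oppLR; apply/eqP/le_anti/andP; split.
  by rewrite Hk0 opprK (inf_enormC_sub_half _ (a k0)).
apply: le_inf_enorm => [|t /= XNt].
  exists ((c k0 + 1) *: a k0) => /(Xk k0).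
  by apply: not_half_scale => //; rewrite ltrDl.
have [k /negP] : exists k, ~ half (a k) (c k) t.
  by apply/existsNP => /XE.
rewrite -ltNge => ct; apply: le_trans (dot_le_enorm _ t (a1 k)).
by apply: le_trans (ler_norm _); have := Hc k; lra.
Qed.

End euclidean_geometry.

(** * Radon's and Helly's theorems *)

Section helly.
Context {R : realType}.

Lemma radon n m (p : 'I_m -> 'rV[R]_n) : (n.+1 < m)%N ->
  exists mu nu : 'I_m -> R,
    [/\ forall i, 0 <= mu i /\ 0 <= nu i,
        forall i, mu i = 0 \/ nu i = 0,
        \sum_i mu i = 1, \sum_i nu i = 1 &
        \sum_i mu i *: p i = \sum_i nu i *: p i].
Proof.
(* Appending a coordinate 1 turns affine dependence of the points into linear dependence of the
   rows; [m] exceeds the number of columns. *)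
move=> nm; pose M : 'M[R]_(m, n + 1) := \matrix_i row_mx (p i) 1.
have [l lM l0] : exists2 l : 'rV_m, l *m M = 0 & l != 0.
  have : kermx M != 0.
    rewrite kermx_eq0 /row_free neq_ltn (leq_ltn_trans (rank_leq_col _))//.
    by rewrite addn1.
  by case/rowV0Pn => l /sub_kermxP lM l0; exists l.
have lp : \sum_i l ord0 i *: p i = 0.
  have := congr1 lsubmx lM; rewrite mulmx_sum_row linear_sum linear0 /=.
  by under eq_bigr do rewrite rowK linearZ /= row_mxKl.
have l1 : \sum_i l ord0 i = 0.
  have := congr1 (fun A => rsubmx A ord0 ord0) lM.
  rewrite mulmx_sum_row linear_sum linear0 summxE mxE /= => s0.
  rewrite -[RHS]s0.
  by apply: eq_bigr => i _; rewrite rowK linearZ /= row_mxKr !mxE mulr1.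
(* The positive and negative parts of the dependence have equal sums and equal weighted points;
   dividing by the common sum [S] gives convex weights. *)
pose mu i := Num.max (l ord0 i) 0; pose nu i := Num.max (- l ord0 i) 0.
have lE i : l ord0 i = mu i - nu i.
  by rewrite /mu /nu; case: (leP (l ord0 i) 0); case: (leP (- l ord0 i) 0); lra.
have mu0 i : 0 <= mu i by rewrite le_max lexx orbT.
have nu0 i : 0 <= nu i by rewrite le_max lexx orbT.
have muE : \sum_i mu i = \sum_i nu i.
  apply/eqP; rewrite -subr_eq0 -sumrB -[X in _ == X]l1; apply/eqP.
  by apply: eq_bigr => i _; rewrite lE.
have pE : \sum_i mu i *: p i = \sum_i nu i *: p i.
  apply/eqP; rewrite -subr_eq0 -sumrB -[X in _ == X]lp; apply/eqP.
  by apply: eq_bigr => i _; rewrite lE scalerBl.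
have S0 : \sum_i mu i != 0.
  apply: contra_neq l0 => s0; apply/rowP => i; rewrite mxE lE.
  have /allP/(_ i (mem_index_enum _))/eqP -> :
      all (fun i => mu i == 0) (index_enum _).
    by have /eqP := s0; rewrite psumr_eq0.
  have /allP/(_ i (mem_index_enum _))/eqP -> :
      all (fun i => nu i == 0) (index_enum _).
    by have /eqP := s0; rewrite muE psumr_eq0.
  by rewrite subrr.
set S := \sum_i mu i in S0 muE.
have Sge : 0 <= S by exact: sumr_ge0.
exists (fun i => S^-1 * mu i), (fun i => S^-1 * nu i); split.
- by move=> i; rewrite !mulr_ge0// invr_ge0.
- move=> i; rewrite /mu /nu; case: (leP (l ord0 i) 0) => li.
    by left; rewrite mulr0.
  by right; rewrite max_r ?mulr0; lra.
- by rewrite -big_distrr /= mulVf.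
- by rewrite -big_distrr /= -muE mulVf.
- under eq_bigr do rewrite -scalerA.
  under [RHS]eq_bigr do rewrite -scalerA.
  by rewrite -!scaler_sumr pE.
Qed.

Lemma half_convex_comb n m (a : 'rV[R]_n) (c : R) (p : 'I_m -> 'rV[R]_n) w :
    (forall i, 0 <= w i) -> \sum_i w i = 1 ->
    (forall i, w i != 0 -> half a c (p i)) ->
  half a c (\sum_i w i *: p i).
Proof.
move=> w0 w1 pac; rewrite /half /= dot_sumr -[leRHS]mul1r -w1 big_distrl /=.
apply: ler_sum => i _; rewrite dotZr.
have [->|wi] := eqVneq (w i) 0; first by rewrite !mul0r.
by rewrite ler_wpM2l//; exact: pac.
Qed.

(* A minimal infeasible subfamily [A] has a witness [p k] violating only the
   constraint [k]; if [A] had more than [n.+1] members, a Radon point of these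
   witnesses would satisfy every constraint of [A]. *)
Lemma helly_half n (T : finType) (a : T -> 'rV[R]_n) (c : T -> R) :
    (forall t, exists k, ~ half (a k) (c k) t) ->
  exists2 A : {set T}, (#|A| <= n.+1)%N &
    forall t, exists2 k, k \in A & ~ half (a k) (c k) t.
Proof.
move=> ac0.
pose P (A : {set T}) :=
  `[< forall t, exists2 k, k \in A & ~ half (a k) (c k) t >].
have [A /minsetP[PA minA]] : {A | minset P A}.
  apply: ex_minset; exists [set: T]%SET; apply/asboolP => t.
  by have [k ?] := ac0 t; exists k; rewrite ?inE.
have {}PA := asboolW PA.
exists A => //; rewrite leqNgt; apply/negP => ltA.
have /fin_all_exists[p pP] : forall k, exists pk : 'rV[R]_n, k \in A ->
    forall l, l \in A -> l != k -> half (a l) (c l) pk.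
  move=> k; have [kA|kA] := boolP (k \in A); last by exists 0.
  apply: contrapT => /forallNP nP.
  (* Without a witness for [k], the family stays infeasible after removal of [k], against
     minimality. *)
  have : k \in A :\ k.
    rewrite (minA (A :\ k))// ?subsetDl//; apply/asboolP => t.
    apply: contrapT => nt; apply: (nP t) => _ l lA lk; apply: contrapT => nl.
    by apply: nt; exists l => //; rewrite !inE lk.
  by rewrite !inE eqxx.
have [mu [nu [munu0 munu mu1 nu1 pE]]] :=
  radon _ _ (fun i : 'I_#|A| => p (enum_val i)) ltA.
have [k kA] := PA (\sum_i mu i *: p (enum_val i)); apply.
have Hk w : (forall i, 0 <= w i) -> \sum_i w i = 1 ->
    w (enum_rank_in kA k) = 0 ->
    half (a k) (c k) (\sum_i w i *: p (enum_val i)).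
  move=> w0 w1 wk; apply: half_convex_comb => // i wi.
  apply: pP => //; first exact: enum_valP.
  apply: contra_neq wi => ki; rewrite -wk; congr w.
  by apply: enum_val_inj; rewrite enum_rankK_in -?ki.
case: (munu (enum_rank_in kA k)) => [mu0|nu0].
  by apply: Hk => // i; case: (munu0 i).
by rewrite pE; apply: Hk => // i; case: (munu0 i).
Qed.

End helly.

(** * Separation and touching of convex sets in the plane *)

Section plane.
Context {R : realType}.
Implicit Types (p t u w : 'rV[R]_2) (A B : set 'rV[R]_2).

Lemma planar_separation (S T : finType) (a : S -> 'rV[R]_2) (c : S -> R)
    (b : T -> 'rV[R]_2) (d : T -> R) :
    (exists z, forall k, half (a k) (c k) z) ->
    (exists z, forall k, half (b k) (d k) z) ->
    ~ (exists z, (forall k, half (a k) (c k) z) /\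
                 (forall k, half (b k) (d k) z)) ->
  (exists k, forall z,
     (forall l, half (b l) (d l) z) -> ~ half (a k) (c k) z) \/
  (exists k, forall z,
     (forall l, half (a l) (c l) z) -> ~ half (b k) (d k) z).
Proof.
move=> [za Xa] [zb Xb] disj.
pose f (k : S + T) := match k with inl s => a s | inr t => b t end.
pose g (k : S + T) := match k with inl s => c s | inr t => d t end.
have fg z : exists k, ~ half (f k) (g k) z.
  apply: contrapT => /forallNP nz; apply: disj; exists z.
  by split=> k; [have := nz (inl k)|have := nz (inr k)] => /contrapT.
have [A A3 AP] := helly_half 2 _ f g fg.
have cardA : (#|inl @^-1: A| + #|inr @^-1: A| = #|A|)%N.
  rewrite -!sum1_card big_sumType /=; congr addn.
    by apply: eq_bigl => i; rewrite inE.
  by apply: eq_bigl => i; rewrite inE.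
(* Of at most three infeasible constraints, one family contributes at most one. A feasible point of
   the other family shows that it contributes exactly one, [k], which every feasible point of the
   other family must violate. *)
have [Al|Al] := leqP #|inl @^-1: A| 1; [left|right].
- have [[k|k] kA nk] := AP zb; last by case: nk; exact: Xb.
  exists k => z zY; have [[l|l] lA nl] := AP z; last by case: nl; exact: zY.
  have -> // : k = l by apply: (card_le1_eqP Al); rewrite inE.
- have Ar : (#|inr @^-1: A| <= 1)%N.
    by rewrite -(leq_add2l 2); apply: leq_trans A3; rewrite -cardA leq_add2r.
  have [[k|k] kA nk] := AP za; first by case: nk; exact: Xa.
  exists k => z zY; have [[l|l] lA nl] := AP z; first by case: nl; exact: zY.
  have -> // : k = l by apply: (card_le1_eqP Ar); rewrite inE.
Qed.

Lemma row2P u w : u ord0 0 = w ord0 0 -> u ord0 1 = w ord0 1 -> u = w.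
Proof.
move=> e0 e1; apply/rowP => -[[|[|//]] i2].
  by rewrite (_ : Ordinal _ = 0) //; apply: val_inj.
by rewrite (_ : Ordinal _ = 1) //; apply: val_inj.
Qed.

(** Cramer's rule with determinant [D]: if [D] is nonzero, the coefficients of [t] depend linearly
    on [t], so they are at most 1 in absolute value for small [t]. *)
Lemma parallel_or_span u w : u != 0 ->
  (exists c, w = c *: u) \/
  exists2 e, 0 < e & forall t, enorm t < e ->
    exists al be, [/\ `|al| <= 1, `|be| <= 1 & t = be *: w - al *: u].
Proof.
move=> u0; set D := u ord0 0 * w ord0 1 - u ord0 1 * w ord0 0.
have [D0|D0] := eqVneq D 0.
  left; have Dw : u ord0 0 * w ord0 1 = u ord0 1 * w ord0 0.
    by apply/eqP; rewrite -subr_eq0 -/D D0.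
  have [u00|u00] := eqVneq (u ord0 0) 0.
    have u01 : u ord0 1 != 0.
      by apply: contra_neq u0 => u01; apply: row2P; rewrite mxE.
    exists (w ord0 1 / u ord0 1); apply: row2P; rewrite mxE; last by field.
    rewrite u00 mulr0; apply: (mulfI u01); rewrite -Dw u00; ring.
  exists (w ord0 0 / u ord0 0); apply: row2P; rewrite mxE; first by field.
  apply: (mulfI u00); rewrite Dw; field; exact: u00.
right; set N := `|u ord0 0| + `|u ord0 1| + `|w ord0 0| + `|w ord0 1|.
have N0 : 0 < N + 1.
  by rewrite ltr_wpDl// !addr_ge0.
exists (`|D| / (N + 1)); first by rewrite divr_gt0// normr_gt0.
move=> t te.
have eD : `|D| / (N + 1) * (N + 1) = `|D| by rewrite divfK// gt_eqF.
have bound x y : `|x| + `|y| <= N ->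
    `|(x * t ord0 0 + y * t ord0 1) / D| <= 1.
  move=> xyN; rewrite normf_div ler_pdivrMr ?normr_gt0// mul1r -eD.
  apply: le_trans (ler_normD _ _) _; rewrite !normrM.
  have t0 := le_trans (coord_le_enorm t 0) (ltW te).
  have t1 := le_trans (coord_le_enorm t 1) (ltW te).
  have e0 := le_trans (normr_ge0 _) t0.
  apply: le_trans (_ : (`|x| + `|y|) * (`|D| / (N + 1)) <= _).
    by rewrite mulrDl lerD// ler_wpM2l.
  by rewrite mulrC ler_wpM2l// (le_trans xyN)// lerDl.
have [u1 u2] : 0 <= `|u ord0 0| /\ 0 <= `|u ord0 1| by rewrite !normr_ge0.
have [w1 w2] : 0 <= `|w ord0 0| /\ 0 <= `|w ord0 1| by rewrite !normr_ge0.
exists ((- w ord0 1 * t ord0 0 + w ord0 0 * t ord0 1) / D).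
exists ((- u ord0 1 * t ord0 0 + u ord0 0 * t ord0 1) / D); split.
- by apply: bound; rewrite normrN /N; lra.
- by apply: bound; rewrite normrN /N; lra.
- by apply: row2P; rewrite !mxE /D; field; exact: D0.
Qed.

Definition segment_closed A :=
  forall x y (s : R), 0 <= s <= 1 -> A x -> A y -> A (s *: x + (1 - s) *: y).

Lemma segment_closed_scale A p u c : segment_closed A ->
  A (p + u) -> A (p - u) -> `|c| <= 1 -> A (p + c *: u).
Proof.
move=> convA Apu Amu; rewrite ler_norml => /andP[c1 c2].
have -> : p + c *: u = (1 + c) / 2 *: (p + u) + (1 - (1 + c) / 2) *: (p - u).
  by apply/rowP => i; rewrite !mxE; field.
by apply: convA => //; lra.
Qed.

(** Extremality in midpoint form; membership of [p] in [A] is stated separately. *)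
Definition extremal A p := forall u, A (p + u) -> A (p - u) -> u = 0.

Lemma not_extremal A p : ~ extremal A p ->
  exists u, [/\ u != 0, A (p + u) & A (p - u)].
Proof.
move=> /existsNP[u /not_implyP[Ap /not_implyP[Am u0]]].
by exists u; split => //; apply/eqP.
Qed.

Lemma touching_point A B : segment_closed A -> segment_closed B ->
    compact (A `&` B) -> A `&` B !=set0 ->
  (exists2 e, 0 < e & forall t, enorm t < e -> minkowski_sub B A t) \/
  exists p, [/\ A p, B p & extremal A p \/ extremal B p].
Proof.
move=> convA convB cAB AB0.
have [p /set_mem[Ap Bp] pmax] := compact_EVT_max AB0 cAB
  (continuous_subspaceT (fun z => dot_continuous z)).
have [eA|/not_extremal[u [u0 Apu Amu]]] := pselect (extremal A p).
  by right; exists p; split => //; left.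
have [eB|/not_extremal[w [w0 Bpw Bmw]]] := pselect (extremal B p).
  by right; exists p; split => //; right.
left; have [[c wcu]|[e e0 span]] := parallel_or_span u w u0.
  (* [p] would be the midpoint of a segment contained in [A `&` B], one end of
     which has larger norm. *)
  have c0 : c != 0 by apply: contra_neq w0 => c0; rewrite wcu c0 scale0r.
  (* With this step length, [g *: u] is a multiple of both [u] and [w] by factors at most 1 in
     absolute value, so [p + g *: u] and [p - g *: u] stay in both sets. *)
  pose g := Num.min 1 `|c|.
  have g0 : 0 < g by rewrite lt_min ltr01 normr_gt0.
  have ABg x : `|x| = g -> dot (p + x *: u) (p + x *: u) <= dot p p.
    move=> xg; apply: pmax; apply/mem_set; split.
      by apply: segment_closed_scale; rewrite // xg ge_min lexx.
    have -> : x *: u = (x / c) *: w by rewrite wcu scalerA divfK.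
    apply: segment_closed_scale => //.
    by rewrite normf_div xg ler_pdivrMr ?normr_gt0// mul1r ge_min lexx orbT.
  have := ABg g (gtr0_norm g0); have := ABg (- g).
  rewrite normrN (gtr0_norm g0) => /(_ erefl).
  rewrite !dotDr !dotDl !dotZr !dotZl.
  have uu : 0 < dot u u.
    rewrite lt_neqAle dot_ge0 andbT eq_sym.
    by apply: contra_neq u0; exact: dot_eq0.
  have : 0 < g * (g * dot u u) by rewrite !mulr_gt0.
  lra.
exists e => // t /span[al [be [al1 be1 ->]]].
exists (p + be *: w); first exact: segment_closed_scale.
exists (p + al *: u); first exact: segment_closed_scale.
by rewrite opprD addrACA subrr add0r.
Qed.

End plane.

(** * Vertices of a single polygon and their motion *)

Section polygon.
Context {R : realType} {n r : nat} (P : state_polygon R n r).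
Hypothesis hP : standing_assumptions P.

Lemma regionE x z :
  region P x z <-> forall k, half (normal P k x) (offset P k x) z.
Proof. by split=> [Pz k|Pz k _]; apply: Pz. Qed.

Lemma segment_closed_region x : segment_closed (region P x).
Proof.
move=> y z s /andP[s0 s1] /regionE Py /regionE Pz; apply/regionE => k.
have := Py k; have := Pz k; rewrite /half /= dotDr !dotZr => {}Pz {}Py.
rewrite (_ : offset P k x = s * offset P k x + (1 - s) * offset P k x).
  by rewrite lerD// ler_wpM2l// subr_ge0.
ring.
Qed.

Lemma closed_region x : closed (region P x).
Proof.
apply: closed_bigI => k _; apply: preimage_closed (@closed_le R _) => z _.
exact: (cvg_dot _ (nbhs z) (fun=> normal P k x) id _ z _ (cvg_cst _) cvg_id).
Qed.

Lemma compact_region x : compact (region P x).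
Proof.
exact: bounded_closed_compact (region_bounded hP x) (closed_region x).
Qed.

Lemma region_nonempty x : region P x !=set0.
Proof.
by have [z /interior_subset Pz] := region_interior hP x; exists z.
Qed.

Lemma vertex_region x k : region P x (vertex P k x).
Proof. by have [] := vertex_extreme hP x k. Qed.

Lemma extremal_vertex x p : region P x p -> extremal (region P x) p ->
  exists k, p = vertex P k x.
Proof.
rewrite (region_hull hP) => -[w [w0 w1 pE]] ext.
have [k wk] : exists k, 0 < w k.
  apply: contrapT => /forallNP wle.
  have : (0 : R) <> 1 by apply/eqP; rewrite eq_sym oner_neq0.
  apply; rewrite -w1 big1// => k _; apply/le_anti; rewrite w0 leNgt.
  by apply/andP; split => //; apply/negP; exact: wle.
(* Moving [p] by [w k] towards or away from the vertex [k] keeps the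
   barycentric weights nonnegative. *)
exists k; have wk1 : w k <= 1.
  by rewrite -w1 (bigD1 k)//= lerDl sumr_ge0.
have hull s : `|s| <= w k -> convex_hull (fun k => vertex P k x)
    (p + s *: (vertex P k x - p)).
  rewrite ler_norml => /andP[s1 s2].
  exists (fun l => (1 - s) * w l + s * (l == k)%:R); split.
  - move=> l; have [->|lk] := eqVneq l k.
      (* This is a rearrangement of the new weight [(1 - s) * w k + s] with visibly nonnegative
         terms. *)
      have : 0 <= (w k + s) * (1 - w k) + w k * w k.
        by rewrite addr_ge0// mulr_ge0//; lra.
      rewrite mulr1; nra.
    by rewrite mulr0 addr0 mulr_ge0//; lra.
  - rewrite big_split /= -!big_distrr /= w1 (bigD1 k)//= eqxx big1 ?addr0.
      by rewrite !mulr1 subrK.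
    by move=> l /negbTE ->.
  - under eq_bigr do rewrite scalerDl -!scalerA.
    rewrite big_split /= -!scaler_sumr -pE (bigD1 k)//= eqxx big1.
      by rewrite addr0 scale1r; apply/rowP => i; rewrite !mxE; ring.
    by move=> l /negbTE ->; rewrite scale0r.
have /eqP : w k *: (vertex P k x - p) = 0.
  apply: ext; first by apply: hull; rewrite ger0_norm.
  by rewrite -scaleNr; apply: hull; rewrite normrN ger0_norm.
by rewrite scaler_eq0 gt_eqF//= subr_eq0 => /eqP.
Qed.

(** A linear form on a convex hull is minimal at a generator. The minimiser may change with [x] but
    ranges over a finite set, which later yields continuity. *)
Lemma region_min x (a : 'rV[R]_2) : exists l,
  forall z, region P x z -> dot a (vertex P l x) <= dot a z.
Proof.
have [z0] := region_nonempty x; rewrite (region_hull hP) => -[w [_ w1 _]].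
have [l0 _] : exists l0 : 'I_r, true.
  apply: contrapT => /forallNP nl.
  have : (0 : R) <> 1 by apply/eqP; rewrite eq_sym oner_neq0.
  by apply; rewrite -w1 big1// => k; case: (nl k).
exists [arg min_(l < l0) dot a (vertex P l x)]%O.
case: arg_minP => // l _ lmin z [{}w [w0 {}w1 ->]].
rewrite dot_sumr -[leLHS]mul1r -w1 big_distrl /=; apply: ler_sum => k _.
by rewrite dotZr ler_wpM2l// lmin.
Qed.

Lemma vertex_push x k K :
    segment_closed K -> K (vertex P k x) -> K° !=set0 ->
  exists u, \forall s \near (0 : R)^'+, exists2 e, 0 < e &
    forall t, enorm t < e -> K (vertex P k (x + s *: u) + t).
Proof.
move=> convK Kv [c Kc]; set v := vertex P k x.
(* The rank condition gives a direction [u] in which the vertex moves towards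
   [c] to first order. *)
have dv : differentiable (vertex P k) x by have [+ _] := vertex_C1 hP k; apply.
have [B BJ] : exists B, B *m 'J (vertex P k) x = 1%:M.
  apply/row_fullP; rewrite /row_full -mxrank_tr.
  exact: vertex_rank hP x k.
exists ((c - v) *m B); set u := _ *m B.
have Du : 'D_u (vertex P k) x = c - v.
  by rewrite deriveEjacobian// -mulmxA BJ mulmx1.
(* Magnifying the displacement of the vertex by [h^-1] gives a point tending to [c], hence
   eventually interior to [K]. *)
have quot : v + h^-1 *: (vertex P k (x + h *: u) - v) @[h --> (0 : R)^'+] --> c.
  rewrite -(subrKC v c) -Du.
  apply: cvgD; first exact: cvg_cst.
  have -> : (fun h => h^-1 *: (vertex P k (x + h *: u) - v)) =
      (fun h => h^-1 *: ((vertex P k \o shift x) (h *: u) - vertex P k x)).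
    by apply/funext => h /=; rewrite [h *: u + x]addrC.
  apply: cvg_dnbhs_at_right; exact: (@diff_derivable _ _ _ _ _ u dv).
have nearK := quot _ (nbhs_interior Kc).
near=> s.
have s0 : 0 < s by near: s; exact: nbhs_right_gt.
have s1 : s < 1 by near: s; exact: nbhs_right_lt.
have : K° (v + s^-1 *: (vertex P k (x + s *: u) - v)) by near: s.
move=> /nbhs_enorm_ball[e e0 Ke]; exists (s * e); first by rewrite mulr_gt0.
move=> t te.
(* The moved vertex divides the segment from [v] to the magnified point with weight [s]; a ball of
   radius [e] around the latter shrinks to radius [s * e]. *)
have -> : vertex P k (x + s *: u) + t =
    s *: (v + s^-1 *: (vertex P k (x + s *: u) - v) + s^-1 *: t) + (1 - s) *: v.
  by apply/rowP => i; rewrite !mxE; field; rewrite gt_eqF.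
apply: convK => //; first by rewrite !ltW.
by apply: Ke; rewrite enormZ gtr0_norm ?invr_gt0// mulrC ltr_pdivrMr// mulrC.
Unshelve. all: by end_near.
Qed.

End polygon.

(** * Continuity of finite minima and maxima *)

Section pair.
Context {R : realType}.

Lemma continuous_min (T : topologicalType) (I : finType) (f : I -> T -> R)
    (m : T -> R) :
  (forall i, continuous (f i)) -> (forall y, exists i, m y = f i y) ->
  (forall y i, m y <= f i y) -> continuous m.
Proof.
move=> fc fm mf x; apply/cvgrPdist_lt => e e0.
(* Finiteness of [I] gives one neighbourhood for all indices; comparing the minimisers at [x] and at
   [y] then bounds the change of [m]. *)
have : \forall y \near x, forall i, `|f i x - f i y| < e.
  by apply: filter_forall => i; have /cvgrPdist_lt := fc i x; apply.
apply: filterS => y fy; rewrite ltr_norml.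
have [i mi] := fm x; have [j mj] := fm y.
have := fy i; have := fy j; rewrite !ltr_norml => /andP[j1 j2] /andP[i1 i2].
have := mf x j; have := mf y i; lra.
Qed.

Lemma continuous_max (T : topologicalType) (I : finType) (f : I -> T -> R)
    (m : T -> R) :
  (forall i, continuous (f i)) -> (forall y, exists i, m y = f i y) ->
  (forall y i, f i y <= m y) -> continuous m.
Proof.
move=> fc fm fle x.
have mc : continuous (fun y => - m y).
  apply: (continuous_min _ _ (fun i y => - f i y)) => [i y|y|y i].
  - by apply: cvgN; exact: fc.
  - by have [i ->] := fm y; exists i.
  - by rewrite lerN2.
rewrite (_ : m = fun y => - - m y); first by apply: cvgN; exact: mc.
by apply/funext => y; rewrite opprK.
Qed.

(** * The half-planes [Q] in explicit form *)

Lemma minkowski_sub_halfr (X : set 'rV[R]_2) a c p :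
  X p -> (forall z, X z -> dot a p <= dot a z) ->
  minkowski_sub X (half a c) = half (- a) (- (dot a p - c)).
Proof.
move=> Xp pmin; apply/seteqP; split => [_ [y Xy [z + <-]]|t].
  by rewrite /half /= dotNl dotBr => zc; have := pmin y Xy; lra.
rewrite /half /= dotNl => tc; exists p => //; exists (p - t).
  by rewrite /half /= dotBr; lra.
by rewrite opprB subrKC.
Qed.

Lemma minkowski_sub_halfl (X : set 'rV[R]_2) a c p :
  X p -> (forall z, X z -> dot a p <= dot a z) ->
  minkowski_sub (half a c) X = half a (- (dot a p - c)).
Proof.
move=> Xp pmin; apply/seteqP; split => [_ [y + [z Xz <-]]|t].
  by rewrite /half /= dotBr => yc; have := pmin z Xz; lra.
rewrite /half /= => tc; exists (p + t); first by rewrite /half /= dotDr; lra.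
by exists p => //; rewrite addrC addKr.
Qed.

Context {n ri rj : nat}.
Context (Pi : state_polygon R n ri) (Pj : state_polygon R n rj).
Hypotheses (hPi : standing_assumptions Pi) (hPj : standing_assumptions Pj).
Implicit Types x : 'rV[R]_(n + n).

Let C x := minkowski_sub (region Pj (rsubmx x)) (region Pi (lsubmx x)).

Lemma Q_lshift k x :
  Q Pi Pj (lshift rj k) x =
  minkowski_sub (region Pj (rsubmx x)) (halfplane Pi k (lsubmx x)).
Proof. by rewrite /Q (unsplitK (inl k)). Qed.

Lemma Q_rshift k x :
  Q Pi Pj (rshift ri k) x =
  minkowski_sub (halfplane Pj k (rsubmx x)) (region Pi (lsubmx x)).
Proof. by rewrite /Q (unsplitK (inr k)). Qed.

(** Signed distance of vertex [l] of one polygon from the line through edge [k] of the other,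
    positive on the outer side. *)
Let gap_l k l x := dot (normal Pi k (lsubmx x)) (vertex Pj l (rsubmx x))
                   - offset Pi k (lsubmx x).

Let gap_r k l x := dot (normal Pj k (rsubmx x)) (vertex Pi l (lsubmx x))
                   - offset Pj k (rsubmx x).

Lemma Q_lshift_half k x : exists l, (forall l', gap_l k l x <= gap_l k l' x) /\
  Q Pi Pj (lshift rj k) x = half (- normal Pi k (lsubmx x)) (- gap_l k l x).
Proof.
have [l lmin] := region_min Pj hPj (rsubmx x) (normal Pi k (lsubmx x)).
exists l; split.
  by move=> l'; rewrite lerB// lmin//; exact: vertex_region.
by rewrite Q_lshift; apply: minkowski_sub_halfr lmin; exact: vertex_region.
Qed.

Lemma Q_rshift_half k x : exists l, (forall l', gap_r k l x <= gap_r k l' x) /\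
  Q Pi Pj (rshift ri k) x = half (normal Pj k (rsubmx x)) (- gap_r k l x).
Proof.
have [l lmin] := region_min Pi hPi (lsubmx x) (normal Pj k (rsubmx x)).
exists l; split.
  by move=> l'; rewrite lerB// lmin//; exact: vertex_region.
by rewrite Q_rshift; apply: minkowski_sub_halfl lmin; exact: vertex_region.
Qed.

Lemma Q_half k x : exists a c, enorm a = 1 /\ Q Pi Pj k x = half a c.
Proof.
case: (fintype.split_ordP k) => k' ->.
  have [l [_ ->]] := Q_lshift_half k' x; exists (- normal Pi k' (lsubmx x)).
  by exists (- gap_l k' l x); rewrite enormN (normal_unit hPi).
have [l [_ ->]] := Q_rshift_half k' x; exists (normal Pj k' (rsubmx x)).
by exists (- gap_r k' l x); rewrite (normal_unit hPj).
Qed.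

Lemma C1_continuous m (W : normedModType R) (f : 'rV[R]_m -> W) :
  C1 f -> continuous f.
Proof. by move=> [df _] x; exact/differentiable_continuous/df. Qed.

Lemma gap_continuous (T : topologicalType) r1 r2 (P1 : state_polygon R n r1)
    (P2 : state_polygon R n r2) (f g : T -> 'rV[R]_n) k l :
    standing_assumptions P1 -> standing_assumptions P2 ->
    continuous f -> continuous g ->
  continuous (fun y => dot (normal P1 k (f y)) (vertex P2 l (g y))
                       - offset P1 k (f y)).
Proof.
move=> h1 h2 fc gc y.
have nf : normal P1 k (f z) @[z --> y] --> normal P1 k (f y).
  by apply: continuous_comp; [exact: fc|exact/C1_continuous/normal_C1].
have vg : vertex P2 l (g z) @[z --> y] --> vertex P2 l (g y).
  by apply: continuous_comp; [exact: gc|exact/C1_continuous/vertex_C1].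
apply: cvgB; first exact: (cvg_dot _ (nbhs y) _ _ _ _ _ nf vg).
by apply: continuous_comp; [exact: fc|exact/C1_continuous/offset_C1].
Qed.

(** The signed distance is the least gap over the vertices, a minimum of finitely many continuous
    functions. *)
Lemma sd_Q_continuous k : continuous (fun x => sd [set 0] (Q Pi Pj k x)).
Proof.
have lc : continuous (lsubmx : 'rV[R]_(n + n) -> 'rV_n).
  exact: continuous_lsubmx.
have rc : continuous (rsubmx : 'rV[R]_(n + n) -> 'rV_n).
  exact: continuous_rsubmx.
case: (fintype.split_ordP k) => k' ->.
  have sdE x : exists l, sd [set 0] (Q Pi Pj (lshift rj k') x) = gap_l k' l x
      /\ forall l', gap_l k' l x <= gap_l k' l' x.
    have [l [lmin ->]] := Q_lshift_half k' x; exists l.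
    by rewrite sd_half ?opprK// enormN (normal_unit hPi).
  apply: (continuous_min _ 'I_rj (gap_l k')) => [l|y|y l].
  - exact: gap_continuous.
  - by have [l [-> _]] := sdE y; exists l.
  - by have [l' [-> ]] := sdE y; apply.
have sdE x : exists l, sd [set 0] (Q Pi Pj (rshift ri k') x) = gap_r k' l x
    /\ forall l', gap_r k' l x <= gap_r k' l' x.
  have [l [lmin ->]] := Q_rshift_half k' x; exists l.
  by rewrite sd_half ?opprK// (normal_unit hPj).
apply: (continuous_min _ 'I_ri (gap_r k')) => [l|y|y l].
- exact: gap_continuous.
- by have [l [-> _]] := sdE y; exists l.
- by have [l' [-> ]] := sdE y; apply.
Qed.

Lemma minkowski_sub_region x t : C x t <-> forall k, Q Pi Pj k x t.
Proof.
split=> [[y Py [z Pz <-]] k|Qt].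
  case: (fintype.split_ordP k) => k' ->; rewrite ?Q_lshift ?Q_rshift.
    by exists y => //; exists z => //; exact: Pz.
  by exists y; [exact: Py|exists z].
apply: contrapT => nCt.
(* Offsets of the first polygon translated by [t]. A separating edge of either polygon would exclude
   [t] from the corresponding [Q]. *)
pose bt k := offset Pi k (lsubmx x) + dot (normal Pi k (lsubmx x)) t.
have shiftE k z : half (normal Pi k (lsubmx x)) (bt k) z <->
    halfplane Pi k (lsubmx x) (z - t).
  by rewrite /half /halfplane /bt /= dotBr lerBlDr.
case: (planar_separation _ _ (normal Pj ^~ (rsubmx x)) (offset Pj ^~ (rsubmx x))
  (normal Pi ^~ (lsubmx x)) bt).
- have [z /regionE Pz] := region_nonempty Pj hPj (rsubmx x).
  by exists z.
- have [z /regionE Pz] := region_nonempty Pi hPi (lsubmx x).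
  by exists (z + t) => k; apply/shiftE; rewrite addrK; exact: Pz.
- move=> [z [Pjz Piz]]; apply: nCt; exists z; first by apply/regionE.
  exists (z - t); last by rewrite opprB subrKC.
  by apply/regionE => k; apply/shiftE.
- move=> [k sep]; have := Qt (rshift ri k); rewrite Q_rshift.
  move=> -[y yk [z Pz tE]].
  apply: sep yk => l; apply/shiftE; rewrite -tE opprB subrKC.
  by move/regionE: Pz; apply.
- move=> [k sep]; have := Qt (lshift rj k); rewrite Q_lshift.
  move=> -[y Py [z zk tE]].
  have /regionE/sep := Py; apply; apply/shiftE.
  by rewrite -tE opprB subrKC.
Qed.

(** * Comparison of [h_a] with [h_s] *)

Lemma index_gt0 : (0 < ri + rj)%N.
Proof.
have [l _] := region_min Pi hPi 0 0.
by rewrite addn_gt0 (leq_ltn_trans (leq0n l) (ltn_ord l)).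
Qed.

Lemma h_a_attained x : exists k, h_a Pi Pj x = sd [set 0] (Q Pi Pj k x).
Proof.
rewrite /h_a; have k0 := Ordinal index_gt0.
have [k _ ->] := eq_bigmax k0 xpredT
  (fun k => (sd [set 0] (Q Pi Pj k x))%:E) isT (fun k _ => leNye _).
by exists k.
Qed.

Lemma h_a_ge x k : sd [set 0] (Q Pi Pj k x) <= h_a Pi Pj x.
Proof.
rewrite /h_a; have k0 := Ordinal index_gt0.
have := le_bigmax -oo%E (fun k => (sd [set 0] (Q Pi Pj k x))%:E) k.
have [l _ ->] := eq_bigmax k0 xpredT
  (fun k => (sd [set 0] (Q Pi Pj k x))%:E) isT (fun k _ => leNye _).
by rewrite lee_fin.
Qed.

Lemma h_a_h_s x : (0 < h_a Pi Pj x -> h_a Pi Pj x <= h_s Pi Pj x) /\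
  (h_a Pi Pj x <= 0 -> h_s Pi Pj x = h_a Pi Pj x).
Proof.
rewrite /h_s sd_minkowski -/(C x).
have /fin_all_exists[a /fin_all_exists[c ac]] := Q_half ^~ x.
have a1 k := (ac k).1; have Qac k := (ac k).2.
have sdE k : sd [set 0] (Q Pi Pj k x) = - c k by rewrite Qac sd_half.
apply: (sd_polyhedron _ a c) => //.
- have [y Py] := region_nonempty Pj hPj (rsubmx x).
  have [z Pz] := region_nonempty Pi hPi (lsubmx x).
  by exists (y - z); exists y => //; exists z.
- move=> t; rewrite minkowski_sub_region.
  by split=> H k; have := H k; rewrite Qac.
- by move=> k; rewrite -sdE; exact: h_a_ge.
- by have [k ->] := h_a_attained x; exists k; rewrite sdE.
Qed.

Lemma h_a_le0 x : h_a Pi Pj x <= 0 -> C x 0.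
Proof.
move=> h0; apply/minkowski_sub_region => k; have := le_trans (h_a_ge x k) h0.
have [a [c [a1 ->]]] := Q_half k x.
by rewrite sd_half// half0 oppr_le0.
Qed.

Lemma enorm_ball_h_s_lt0 x e : 0 < e -> (forall t, enorm t < e -> C x t) ->
  h_s Pi Pj x < 0.
Proof.
move=> e0 eC; suff h0 : h_a Pi Pj x < 0.
  by rewrite (h_a_h_s x).2// ltW.
have [k ->] := h_a_attained x; have [a [c [a1 Qac]]] := Q_half k x.
rewrite Qac sd_half// oppr_lt0 ltNge; apply/negP => c0.
(* If [c <= 0], the half-plane attaining [h_a] omits [(e / 2) *: a], although this point lies in the
   ball contained in [C x]. *)
apply: (not_half_scale a c (e / 2)) => //; first by lra.
rewrite -Qac; apply: (minkowski_sub_region x _).1; apply: eC.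
by rewrite enormZ a1 mulr1 gtr0_norm; lra.
Qed.

Lemma h_a_continuous : continuous (h_a Pi Pj).
Proof.
exact: continuous_max sd_Q_continuous h_a_attained h_a_ge.
Qed.

(** The two functions coincide where [h_a] is nonpositive and are both positive elsewhere. *)
Lemma safe_setE x : safe_set Pi Pj x <-> 0 <= h_a Pi Pj x.
Proof.
have [pos neg] := h_a_h_s x; have [h0|h0] := leP (h_a Pi Pj x) 0.
  by rewrite /safe_set /= neg.
by rewrite (ltW h0); split => // _; exact/ltW/(lt_le_trans h0)/pos.
Qed.

(** * Perturbation of points where [h_a] vanishes *)

Lemma not_interior_of_unsafe_ray x w :
    (\forall s \near (0 : R)^'+, h_s Pi Pj (x + s *: w) < 0) ->
  ~ (safe_set Pi Pj)° x.
Proof.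
move=> neg Sx.
have ray : x + s *: w @[s --> (0 : R)^'+] --> x + (0 : R) *: w.
  apply: cvg_at_right_filter; apply: cvgD; first exact: cvg_cst.
  by apply: cvgZ; [exact: cvg_id|exact: cvg_cst].
rewrite scale0r addr0 in ray.
have [s [/= neg_s]] := filter_ex (filterI neg (ray _ Sx)).
by rewrite /safe_set /= leNgt neg_s.
Qed.

Lemma h_a_eq0_not_interior x : h_a Pi Pj x = 0 -> ~ (safe_set Pi Pj)° x.
Proof.
move=> h0 Sx.
have [z Pjz [y Piy zy]] : C x 0 by apply: h_a_le0; rewrite h0.
have {zy} zy : z = y by apply/eqP; rewrite -subr_eq0 zy.
rewrite {}zy in Pjz.
case: (touching_point (region Pi (lsubmx x)) (region Pj (rsubmx x))).
- exact: segment_closed_region.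
- exact: segment_closed_region.
- apply: compact_closedI; first exact: compact_region.
  exact: closed_region.
- by exists y.
- move=> [e e0 eC]; have := enorm_ball_h_s_lt0 x e e0 eC.
  by rewrite ltNge; apply/negP; rewrite negbK; exact: (interior_subset Sx).
- move=> [p [Pip Pjp [ext|ext]]].
  + have [k pk] := extremal_vertex _ hPi _ _ Pip ext.
    have [u push] := vertex_push _ hPi (lsubmx x) k (region Pj (rsubmx x))
      (segment_closed_region _ _) (eq_ind _ _ Pjp _ pk) (region_interior hPj _).
    apply: (not_interior_of_unsafe_ray x (row_mx u 0)) Sx.
    (* Only the first state moves: [t] is the difference between the pushed vertex plus [t], in the
       second polygon, and the pushed vertex itself, in the first. *)
    apply: filterS push => s [e e0 eP].
    apply: (enorm_ball_h_s_lt0 _ _ e0) => t te.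
    rewrite /C !linearD !linearZ /= row_mxKl row_mxKr scaler0 addr0.
    exists (vertex Pi k (lsubmx x + s *: u) + t); first exact: eP.
    exists (vertex Pi k (lsubmx x + s *: u)); first exact: vertex_region.
    by rewrite addrC addKr.
  + have [k pk] := extremal_vertex _ hPj _ _ Pjp ext.
    have [u push] := vertex_push _ hPj (rsubmx x) k (region Pi (lsubmx x))
      (segment_closed_region _ _) (eq_ind _ _ Pip _ pk) (region_interior hPi _).
    apply: (not_interior_of_unsafe_ray x (row_mx 0 u)) Sx.
    apply: filterS push => s [e e0 eP].
    apply: (enorm_ball_h_s_lt0 _ _ e0) => t te.
    rewrite /C !linearD !linearZ /= row_mxKl row_mxKr scaler0 addr0.
    exists (vertex Pj k (rsubmx x + s *: u)); first exact: vertex_region.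
    exists (vertex Pj k (rsubmx x + s *: u) - t); last by rewrite opprB subrKC.
    by apply: eP; rewrite enormN.
Qed.

End pair.

(** * The safe set, its interior and its frontier by the sign of [h_a] *)

Theorem theorem1 (R : realType) (n : nat) (hn : (2 <= n)%N) (ri rj : nat)
    (Pi : state_polygon R n ri) (Pj : state_polygon R n rj)
    (hPi : standing_assumptions Pi) (hPj : standing_assumptions Pj) :
  [/\ forall x : 'rV[R]_(n + n),
        safe_set Pi Pj x -> h_a Pi Pj x <= h_s Pi Pj x,
      closure (~` safe_set Pi Pj) =
        frontier (safe_set Pi Pj) `|` ~` safe_set Pi Pj &
      forall x : 'rV[R]_(n + n),
        closure (~` safe_set Pi Pj) x -> h_s Pi Pj x = h_a Pi Pj x]
  /\
  forall x : 'rV[R]_(n + n),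
    [/\ h_a Pi Pj x = 0 <-> frontier (safe_set Pi Pj) x,
        0 < h_a Pi Pj x <-> (safe_set Pi Pj)° x &
        h_a Pi Pj x < 0 <-> (~` safe_set Pi Pj) x].
Proof.
have SE := safe_setE Pi Pj hPi hPj.
have hc : continuous (h_a Pi Pj) by exact: h_a_continuous.
have openP : open [set x | 0 < h_a Pi Pj x].
  exact: (open_comp (fun x _ => hc x) (@open_gt R 0)).
have SN x : (~` safe_set Pi Pj) x <-> h_a Pi Pj x < 0.
  by rewrite ltNge; split => [nS|/negP nh /SE//]; apply/negP => /SE.
have SI x : (safe_set Pi Pj)° x <-> 0 < h_a Pi Pj x.
  split=> [Sx|hx].
    rewrite lt_neqAle (SE x).1 ?andbT; last exact: interior_subset.
    by apply/eqP => h0; apply: (h_a_eq0_not_interior Pi Pj hPi hPj x (esym h0)).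
  apply: (filterS _ (open_nbhs_nbhs (conj openP hx))) => y hy.
  by apply/SE/ltW.
have Sclosed : closed (safe_set Pi Pj).
  rewrite (_ : safe_set Pi Pj = h_a Pi Pj @^-1` [set y | 0 <= y]).
    by apply: preimage_closed (@closed_ge R 0) => x _; exact: hc.
  by apply/seteqP; split => x /SE.
have frontierE x : frontier (safe_set Pi Pj) x <-> h_a Pi Pj x = 0.
  (* For a closed set the frontier is the set minus its interior, where [h_a] is nonnegative but not
     positive. *)
  rewrite /frontier -(closure_id _).1//=; split=> [[/SE h0 nI]|h0].
    by apply/le_anti; rewrite h0 andbT leNgt; apply/negP => /SI.
  by split; [apply/SE; rewrite h0|move=> /SI; rewrite h0 ltxx].
split; last by move=> x; split; apply: iff_sym.
split.
- move=> x /SE h0; have [pos neg] := h_a_h_s Pi Pj hPi hPj x.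
  by have [/neg->//|/pos] := leP (h_a Pi Pj x) 0.
- rewrite closure_setC; apply/seteqP; split => x.
    move=> nI; have [Sx|nS] := pselect (safe_set Pi Pj x); last by right.
    by left; split => //; exact: subset_closure.
  by move=> [[]//|nS /interior_subset].
(* The closure of the complement is the complement of the interior, on which [h_a] is
   nonpositive. *)
- move=> x; rewrite closure_setC => nI; apply: (h_a_h_s Pi Pj hPi hPj x).2.
  by rewrite leNgt; apply/negP => /SI.
Qed.
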